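(* Every torsion-free self-replicating bounded automata group admits a faithful representation as a generalized basilica group; that is, if $X$ is a finite set with $|X|\geq 2$ and $G\le\mathrm{Aut}(X^* )$ is a torsion-free self-replicating bounded automata group, then $G$ is isomorphic to a generalized basilica group $H\le\mathrm{Aut}(O^* )$ for some finite set $O$.
   Context: For a finite set $X$ with $|X|\ge 2$, $X^*$ is the free monoid on $X$, viewed as a rooted tree (its Cayley graph), and $X^k$ is the set of words of length $k$. $\mathrm{Aut}(X^* )$ is the group of bijections $g$ of $X^*$ such that $a$ is a prefix of $b$ if and only if $g(a)$ is a prefix of $g(b)$. For $g\in\mathrm{Aut}(X^* )$ and $w\in X^*$, the section $g_w\in \mathrm{Aut}(X^* )$ is the automorphism determined by $g(wu)=g(w)g_w(u)$ for all $u\in X^*$. A group $G\le \mathrm{Aut}(X^* )$ is self-similar if $g_w\in G$ for all $g\in G$, $w\in X^*$. It is self-replicating if it is self-similar, acts transitively on $X$, and $\{g_x\mid g\in G,\ g(x)=x\}=G$ for all $x\in X$. An element $g$ is finite state if $\{g_v\mid v\in X^*\}$ is finite, and bounded if there is $N\ge 0$ such that $|\{v\in X^n\mid g_v\ne 1\}|\le N$ for all $n\ge 1$. $G$ is a bounded automata group if it is finitely generated, self-similar, and every element of $G$ is bounded and finite state. A group $H\le\mathrm{Aut}(O^* )$ ($O$ finite, $|O|\geq 2$) is a generalized basilica group if it admits a finite generating set $Y$ such that for every $g\in Y$ either $g_x=1$ for all $x\in O$, or $g_x\in\{1,g\}$ for all $x\in O$ with exactly one $x\in O$ such that $g_x=g$.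 *)

(* Defs.v *)
From HB Require Import structures.
From mathcomp Require Import all_boot.
From mathcomp Require Import boolp classical_sets functions cardinality.

Set Implicit Arguments.
Unset Strict Implicit.
Unset Printing Implicit Defensive.

Local Open Scope classical_set_scope.
Local Open Scope group_scope.

(* The free monoid on X is seq X, with concatenation. *)
Record treeAut (X : finType) := TreeAut {
  treeAut_fun :> seq X -> seq X;
  treeAut_bij : bijective treeAut_fun;
  treeAut_prefix :
    forall a b, prefix a b = prefix (treeAut_fun a) (treeAut_fun b) }.

Lemma treeAutP (X : finType) (g h : treeAut X) : g =1 h -> g = h.
Proof.
case: g h => [g g1 g2] [h h1 h2] /= /funext e; subst h.
by rewrite (Prop_irrelevance h1 g1) (Prop_irrelevance h2 g2).
Qed.

HB.instance Definition _ (X : finType) := gen_eqMixin (treeAut X).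
HB.instance Definition _ (X : finType) := gen_choiceMixin (treeAut X).

Definition treeAut_one (X : finType) : treeAut X :=
  @TreeAut X id (inv_bij (frefl _)) (fun _ _ => erefl).

Lemma treeAut_mul_prefix (X : finType) (g h : treeAut X) a b :
  prefix a b = prefix ((g \o h) a) ((g \o h) b).
Proof. by rewrite /= -!treeAut_prefix. Qed.

Definition treeAut_mul (X : finType) (g h : treeAut X) : treeAut X :=
  TreeAut (bij_comp (treeAut_bij g) (treeAut_bij h)) (treeAut_mul_prefix g h).

Lemma treeAut_inv_subproof (X : finType) (g : treeAut X) :
  exists h : treeAut X, cancel g h /\ cancel h g.
Proof.
case: (treeAut_bij g) => h gK hK.
have hp a b : prefix a b = prefix (h a) (h b).
  by rewrite (treeAut_prefix g (h a)) !hK.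
by exists (TreeAut (Bijective hK gK) hp).
Qed.

Definition treeAut_inv (X : finType) (g : treeAut X) : treeAut X :=
  projT1 (cid (treeAut_inv_subproof g)).

Lemma treeAut_mulA (X : finType) : associative (@treeAut_mul X).
Proof. by move=> f g h; apply: treeAutP. Qed.

Lemma treeAut_mul1g (X : finType) :
  left_id (treeAut_one X) (@treeAut_mul X).
Proof. by move=> g; apply: treeAutP. Qed.

Lemma treeAut_mulg1 (X : finType) :
  right_id (treeAut_one X) (@treeAut_mul X).
Proof. by move=> g; apply: treeAutP. Qed.

Lemma treeAut_mulVg (X : finType) :
  left_inverse (treeAut_one X) (@treeAut_inv X) (@treeAut_mul X).
Proof.
by move=> g; apply: treeAutP => u /=; case: (projT2 (cid (treeAut_inv_subproof g))).
Qed.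

Lemma treeAut_mulgV (X : finType) :
  right_inverse (treeAut_one X) (@treeAut_inv X) (@treeAut_mul X).
Proof.
by move=> g; apply: treeAutP => u /=; case: (projT2 (cid (treeAut_inv_subproof g))).
Qed.

HB.instance Definition _ (X : finType) := isGroup.Build (treeAut X)
  (@treeAut_mulA X) (@treeAut_mul1g X) (@treeAut_mulg1 X)
  (@treeAut_mulVg X) (@treeAut_mulgV X).

Definition section_fun (X : finType) (g : treeAut X) (w u : seq X) : seq X :=
  drop (size (g w)) (g (w ++ u)).

Lemma section_funE (X : finType) (g : treeAut X) (w u : seq X) :
  g (w ++ u) = g w ++ section_fun g w u.
Proof.
have: prefix (g w) (g (w ++ u)) by rewrite -treeAut_prefix prefix_prefix.
by rewrite /section_fun => /prefixP[v ->]; rewrite drop_size_cat.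
Qed.

Lemma section_bij (X : finType) (g : treeAut X) (w : seq X) :
  bijective (section_fun g w).
Proof.
case: (treeAut_bij g) => h gK hK.
exists (fun v => drop (size w) (h (g w ++ v))) => v.
  by rewrite -section_funE gK drop_size_cat.
have: prefix w (h (g w ++ v)).
  by rewrite (treeAut_prefix g) hK prefix_prefix.
move=> /prefixP[u e]; rewrite e drop_size_cat//.
by rewrite /section_fun -e hK drop_size_cat.
Qed.

Lemma section_prefix (X : finType) (g : treeAut X) (w a b : seq X) :
  prefix a b = prefix (section_fun g w a) (section_fun g w b).
Proof.
have cat2l (s : seq X) : prefix (s ++ a) (s ++ b) = prefix a b.
  by elim: s => //= x s IH; rewrite eqxx.
rewrite -(cat2l w) (treeAut_prefix g) !section_funE.
by elim: (g w) => //= x s IH; rewrite eqxx.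
Qed.

Definition section (X : finType) (g : treeAut X) (w : seq X) : treeAut X :=
  TreeAut (section_bij g w) (section_prefix g w).

Lemma sectionE (X : finType) (g : treeAut X) (w u : seq X) :
  g (w ++ u) = g w ++ section g w u.
Proof. exact: section_funE. Qed.

Definition subgroup (T : groupType) (G : set T) : Prop := group_closed [in G].

Definition generated (T : groupType) (Y : set T) : set T :=
  smallest (@subgroup T) Y.

Definition finitely_generated (T : groupType) (G : set T) : Prop :=
  exists Y : set T, finite_set Y /\ generated Y = G.

Definition torsion_free (T : groupType) (G : set T) : Prop :=
  forall (g : T) (n : nat), G g -> (0 < n)%N -> g ^+ n = 1 -> g = 1.

Definition isomorphic (T U : groupType) (G : set T) (H : set U) : Prop :=
  exists f : T -> U,
    {in G &, {morph f : g h / g * h}} /\ set_bij G H f.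

Definition self_similar (X : finType) (G : set (treeAut X)) : Prop :=
  forall g w, G g -> G (section g w).

Definition letter_transitive (X : finType) (G : set (treeAut X)) : Prop :=
  forall x y : X, exists2 g, G g & g [:: x] = [:: y].

Definition self_replicating (X : finType) (G : set (treeAut X)) : Prop :=
  [/\ self_similar G, letter_transitive G &
      forall x : X,
        [set section g [:: x] | g in [set g | G g /\ g [:: x] = [:: x]]] = G].

Definition finite_state (X : finType) (g : treeAut X) : Prop :=
  finite_set [set section g v | v in [set: seq X]].

Definition bounded (X : finType) (g : treeAut X) : Prop :=
  exists N : nat, forall n : nat, (1 <= n)%N ->
    (#|[pred v : n.-tuple X | section g v != 1%g]| <= N)%N.

Definition bounded_automata_group (X : finType) (G : set (treeAut X)) : Prop :=
  [/\ finitely_generated G, self_similar G &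
      forall g, G g -> bounded g /\ finite_state g].

Definition generalized_basilica_group (O : finType) (H : set (treeAut O)) :
    Prop :=
  [/\ (2 <= #|O|)%N, subgroup H &
      exists Y : set (treeAut O),
        [/\ finite_set Y, generated Y = H &
            forall g, Y g ->
              (forall x : O, section g [:: x] = 1) \/
              ((forall x : O, section g [:: x] = 1 \/ section g [:: x] = g) /\
               (exists! x : O, section g [:: x] = g))]].

(* Main.v *)
From mathcomp Require Import all_boot fingroup perm.
From mathcomp Require Import boolp classical_sets cardinality.
Require Import Defs.

(** The idea is to pass to a power of the alphabet after discarding everything
    finitary.

    If all the sections of [g] at some level are trivial, then [g] has finite
    order, since it acts on the deeper levels through its permutation of that
    level ([finitary_torsion]).  In a torsion-free self-similar group every
    nontrivial element therefore has a nontrivial section at every level, so the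
    number of nontrivial sections of [g] at level [n] is nondecreasing in [n].
    When [g] is bounded this number reaches a maximum, and from then on each
    nontrivial section has exactly one nontrivial section at every level below
    ([eventually_thin]).  The nontrivial sections of such a section lie along one
    infinite ray, and when [g] is finite state one of them recurs along the ray:
    deep enough, each section [h] of [g] is [directed], meaning that it recurs as
    its own section at some nonempty word [w] and that all its other sections at
    the level of [w] are trivial ([eventually_directed]).

    Choose a level [n] that works for all the elements of a finite generating set
    [S] of [G].  By self-replication every element of [G] is the section at a word
    [w] of length [n] of an element of [G] fixing [w]; writing the latter as a
    product of generators shows that the finite set [Y] of sections of [S] at
    level [n] still generates [G] ([generated_by_sections]).  The elements of [Y]
    are directed, with a common period [m] ([common_period]): each nontrivial [y]
    in [Y] satisfies [section y w = y] for one word [w] of length [m], and its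
    sections at the other words of length [m] are trivial.

    This is the generalized basilica condition for words of length [m] regarded
    as letters.  Cutting words into blocks of length [m] embeds the automorphism
    group of the tree over [X] into that of the tree over [m.-tuple X] by a
    homomorphism [block] commuting with sections ([section_block], [block_inj]),
    and the image of [G] under [block] is the required group. *)

Set Implicit Arguments.
Unset Strict Implicit.
Unset Printing Implicit Defensive.

Local Open Scope classical_set_scope.
Local Open Scope group_scope.

(** * Sections and the action on levels *)

Section TreeAut.
Variable X : finType.
Implicit Types (g h : treeAut X) (u v w : seq X).

Lemma treeAut_injective g : injective g.
Proof. exact: bij_inj (treeAut_bij g). Qed.

Lemma treeAut_nil g : g [::] = [::].
Proof.
have [h gK hK] := treeAut_bij g.
have := treeAut_prefix g [::] (h [::]).
by rewrite hK prefix0s; case: (g _).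
Qed.

(** The words [[::]] and [[:: x]] are the only prefixes of [[:: x]], so their
    images are the only prefixes of [g [:: x]]. *)
Lemma treeAut_size1 g x : size (g [:: x]) = 1%N.
Proof.
have [h gK hK] := treeAut_bij g.
case e: (g [:: x]) => [|a s].
  by have := treeAut_injective (etrans e (esym (treeAut_nil g))).
have: prefix (h [:: a]) [:: x].
  by rewrite (treeAut_prefix g) hK e /= eqxx prefix0s.
case e': (h [:: a]) => [|b t].
  by have := hK [:: a]; rewrite e' treeAut_nil.
rewrite prefix_cons prefixs0 => /andP[/eqP eb /eqP et]; subst.
by have := hK [:: a]; rewrite e' e => -[->].
Qed.

Lemma treeAut_size g w : size (g w) = size w.
Proof.
elim: w g => [|x w IH] g; first by rewrite treeAut_nil.
by rewrite -cat1s sectionE size_cat treeAut_size1 IH.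
Qed.

Lemma mulE g h w : (g * h) w = g (h w).
Proof. by []. Qed.

Lemma section_nil g : section g [::] = g.
Proof.
by apply: treeAutP => u; rewrite -[RHS]/(g ([::] ++ u)) sectionE treeAut_nil.
Qed.

Lemma section_uniq g h w :
  (forall u, g (w ++ u) = g w ++ h u) -> section g w = h.
Proof.
move=> e; apply: treeAutP => u; have /eqP := e u.
by rewrite sectionE eqseq_cat// eqxx => /eqP.
Qed.

Lemma section1 w : section (1 : treeAut X) w = 1.
Proof. exact: section_uniq. Qed.

Lemma section_cat g u v : section g (u ++ v) = section (section g u) v.
Proof. by apply: section_uniq => w; rewrite -catA !sectionE catA. Qed.

Lemma sectionM g h w : section (g * h) w = section g (h w) * section h w.
Proof. by apply: section_uniq => u; rewrite !mulE !sectionE. Qed.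

Lemma sectionV g w : section g^-1 w = (section g (g^-1 w))^-1.
Proof.
by apply: (mulgI (section g (g^-1 w))); rewrite -sectionM !mulgV section1.
Qed.

(** Levels are preserved, so fixing an extension of [w] forces fixing [w]; this
    reduces triviality to words of convenient length. *)
Lemma treeAut_eq1 g : (forall w, exists u, g (w ++ u) = w ++ u) -> g = 1.
Proof.
move=> fix_g; apply: treeAutP => w; have [u /eqP] := fix_g w.
by rewrite sectionE eqseq_cat ?treeAut_size// => /andP[/eqP].
Qed.

Definition level_perm_fun n g (t : n.-tuple X) : n.-tuple X :=
  Tuple (introT eqP (etrans (treeAut_size g t) (size_tuple t))).

Lemma level_perm_inj n g : injective (@level_perm_fun n g).
Proof. by move=> s t [/treeAut_injective e]; apply: val_inj. Qed.

Lemma tuple_of_size n w : size w = n -> exists t : n.-tuple X, tval t = w.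
Proof. by move=> /eqP sw; exists (Tuple sw). Qed.

(** The exponent is the order of the permutation induced by [g] on the words of
    length [n]: the sections of the powers of [g] at these words are products of
    trivial ones. *)
Lemma finitary_torsion g n : (0 < #|X|)%N ->
  (forall w, size w = n -> section g w = 1) ->
  exists2 k, (0 < k)%N & g ^+ k = 1.
Proof.
move=> /card_gt0P[x0 _] fin_g.
pose p := perm (@level_perm_inj n g).
exists #[p]; first exact: order_gt0.
have section_pow k w : size w = n -> section (g ^+ k) w = 1.
  move=> sw; elim: k => [|k IH]; first by rewrite expg0 section1.
  by rewrite expgS sectionM IH fin_g ?mulg1// treeAut_size.
have pow k (t : n.-tuple X) : (g ^+ k) t = (p ^+ k) t :> seq X.
  elim: k => [|k IH]; first by rewrite !expg0 perm1.
  by rewrite expgS mulE IH expgSr permM /p permE.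
(* The padding gives even a short word a prefix of length n. *)
apply: treeAut_eq1 => w; exists (nseq n x0).
set s := w ++ _.
have /tuple_of_size[t et] : size (take n s) = n.
  by rewrite size_takel// size_cat size_nseq leq_addl.
rewrite -(cat_take_drop n s) sectionE -et pow expg_order perm1 section_pow//.
exact: size_tuple.
Qed.

(** * Directed automorphisms *)

(** All the nontrivial sections lie along one ray. *)
Definition thin g := forall u v, size u = size v ->
  section g u != 1 -> section g v != 1 -> u = v.

(** Elements on a cycle of a bounded automaton; the identity is included so that
    the property passes to sections. *)
Definition directed g := thin g /\ exists2 w, w != [::] & section g w = g.

Lemma directed1 : (0 < #|X|)%N -> directed 1.
Proof.
move=> /card_gt0P[x0 _]; split; first by move=> u v _; rewrite section1 eqxx.
by exists [:: x0]; rewrite ?section1.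
Qed.

Lemma section_neq1_prefix g u v : section g (u ++ v) != 1 -> section g u != 1.
Proof. by rewrite section_cat; apply: contraNneq => ->; rewrite section1. Qed.

Lemma thin_section g w : thin g -> thin (section g w).
Proof.
move=> thin_g u v euv; rewrite -!section_cat => nu nv.
have /eqP : w ++ u = w ++ v by apply: thin_g; rewrite // !size_cat euv.
by rewrite eqseq_cat// eqxx => /eqP.
Qed.

(** If [g] recurs at [y :: t] and [section g [:: x]] is nontrivial, then [x = y]
    by thinness, and that section recurs at the rotated word [rcons t x]. *)
Lemma directed_section g w : directed g -> directed (section g w).
Proof.
elim: w g => [|x w IH] g dir_g; first by rewrite section_nil.
rewrite -cat1s section_cat; apply: IH.
have X_gt0 : (0 < #|X|)%N by apply/card_gt0P; exists x.
have [->|nx] := eqVneq (section g [:: x]) 1; first exact: directed1.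
have [thin_g [w' nw' w'P]] := dir_g; split; first exact: thin_section.
case: w' nw' w'P => [|y t _ ytP]; first by rewrite eqxx.
exists (rcons t x); first by case: t {ytP}.
have g_neq1 : g != 1 by apply: contraNneq nx => ->; rewrite section1.
have ny : section g [:: y] != 1.
  by apply: (@section_neq1_prefix _ _ t); rewrite /= ytP.
have [eyx] : [:: y] = [:: x] by apply: thin_g.
by rewrite -section_cat cat1s -cats1 -cat_cons section_cat -eyx ytP.
Qed.

Lemma section_iter g w k :
  section g w = g -> section g (flatten (nseq k w)) = g.
Proof.
move=> gw; elim: k => [|k IH]; first by rewrite section_nil.
by rewrite /= section_cat gw.
Qed.

End TreeAut.

(** * Deep sections in a torsion-free group *)

Section NoFinitary.
Variables (X : finType) (G : set (treeAut X)).
Hypotheses (X_gt0 : (0 < #|X|)%N) (tfG : torsion_free G) (ssG : self_similar G).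
Implicit Types (g h : treeAut X) (u v w : seq X).

Lemma nontrivial_section g n : G g -> g != 1 ->
  exists2 w, size w = n & section g w != 1.
Proof.
move=> Gg; apply: contraNP => no_w; apply/eqP.
have [w sw|k k_gt0 gk1] := @finitary_torsion X g n X_gt0; last exact: tfG gk1.
by apply: contrapT => /eqP nw; apply: no_w; exists w.
Qed.

(** Choose a level with the largest number of nontrivial sections.  If a section
    there had two nontrivial sections at depth [k], truncation would map the
    words with nontrivial section [k] levels below onto those of the chosen level
    without being injective, so there would be more than the maximum. *)
Lemma eventually_thin g : G g -> bounded g ->
  exists n, forall w, size w = n -> thin (section g w).
Proof.
move=> Gg [N boundN].
pose A n := [pred v : n.-tuple X | section g v != 1].
(* Level 0 is excluded because N only bounds the levels k > 0. *)
pose P n := `[< exists2 k, (0 < k)%N & #|A k| = n >].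
have exP : exists n, P n by exists #|A 1%N|; apply/asboolP; exists 1%N.
have ubP n : P n -> (n <= N)%N by move=> /asboolP[k k_gt0 <-]; apply: boundN.
case: (ex_maxnP exP ubP) => _ /asboolP[n n_gt0 <-] maxA.
exists n => w sw u v euv; rewrite -!section_cat => nu nv.
pose k := size u.
have [r rE] : exists r : (n + k).-tuple X -> n.-tuple X,
    forall t, r t = take n t :> seq X.
  have st (t : (n + k).-tuple X) : size (take n t) == n.
    by rewrite size_takel// size_tuple leq_addr.
  by exists (fun t => Tuple (st t)).
have rA : r @: A (n + k)%N =i A n.
  move=> t; apply/imsetP/idP => [[s sA ->]|tA].
    move: sA; rewrite !inE rE -{1}(cat_take_drop n s).
    exact: section_neq1_prefix.
  have [|z sz nz] := @nontrivial_section (section g t) k _ tA; first exact: ssG.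
  have /tuple_of_size[s es] : size (t ++ z) = (n + k)%N.
    by rewrite size_cat size_tuple sz.
  exists s; first by rewrite inE es section_cat.
  by apply: val_inj; rewrite /= rE es take_size_cat// size_tuple.
have /imset_injP r_inj : #|r @: A (n + k)%N| == #|A (n + k)%N|.
  rewrite eqn_leq leq_imset_card (eq_card rA).
  by apply: maxA; apply/asboolP; exists (n + k)%N; rewrite // addn_gt0 n_gt0.
have /tuple_of_size[s es] : size (w ++ u) = (n + k)%N by rewrite size_cat sw.
have /tuple_of_size[t et] : size (w ++ v) = (n + k)%N.
  by rewrite size_cat sw /k euv.
have/(congr1 val)/= : s = t.
  apply: r_inj; rewrite ?inE ?es ?et//.
  by apply: val_inj; rewrite /= !rE es et !take_size_cat.
by rewrite es et => /eqP; rewrite eqseq_cat// eqxx => /eqP.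
Qed.

(** A nontrivial thin [g] has one nontrivial section on each level, along a ray;
    as [g] has finitely many sections, two of these coincide, and this section
    recurs at the segment of the ray between the two places. *)
Lemma thin_eventually_directed g : G g -> finite_state g -> thin g ->
  exists n, forall w, size w = n -> directed (section g w).
Proof.
move=> Gg fin_g thin_g.
have [->|g_neq1] := eqVneq g 1.
  by exists 0%N => w _; rewrite section1; apply: directed1.
have /choice[ray rayP] : forall n, exists w, size w = n /\ section g w != 1.
  by move=> n; have [w] := nontrivial_section n Gg g_neq1; exists w.
have [i [j [ltij eij]]] :
    exists i j, (i < j)%N /\ section g (ray i) = section g (ray j).
  apply: contrapT => no_ij; apply: infinite_nat.
  have <- : (fun n => section g (ray n)) @^-1`
      [set section g v | v in [set: seq X]] = [set: nat].
    by apply/seteqP; split=> // k _; exists (ray k).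
  apply: finite_preimage fin_g => i j _ _ eij.
  by have [ij|ji|//] := ltngtP i j; case: no_ij; [exists i, j|exists j, i].
exists i => w sw.
have [->|nw] := eqVneq (section g w) 1; first exact: directed1.
have [si ni] := rayP i; have [sj nj] := rayP j.
have ->: w = ray i by apply: thin_g; rewrite // sw.
have ei : take i (ray j) = ray i.
  apply: thin_g; rewrite ?size_takel ?si ?sj 1?ltnW//.
  by apply: (@section_neq1_prefix _ _ _ (drop i (ray j))); rewrite cat_take_drop.
split; first exact: thin_section.
exists (drop i (ray j)); first by rewrite -size_eq0 size_drop sj -lt0n subn_gt0.
by rewrite -section_cat -{1}ei cat_take_drop.
Qed.

Lemma eventually_directed g : G g -> bounded g -> finite_state g ->
  exists n, forall w, (n <= size w)%N -> directed (section g w).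
Proof.
move=> Gg bg fg.
have [n thin_n] := eventually_thin Gg bg.
have fsec w : finite_state (section g w).
  apply: sub_finite_set fg => _ [v _ <-]; exists (w ++ v) => //.
  exact: section_cat.
have /choice[f fP] : forall t : n.-tuple X, exists k, forall w, size w = k ->
    directed (section (section g t) w).
  move=> t; apply: thin_eventually_directed; first exact: ssG.
  - exact: fsec.
  - by apply: thin_n; apply: size_tuple.
exists (n + \max_t f t)%N => w le_w.
have /tuple_of_size[t et] : size (take n w) = n.
  by rewrite size_takel// (leq_trans _ le_w)// leq_addr.
rewrite -(cat_take_drop n w) -et section_cat.
rewrite -(cat_take_drop (f t) (drop n w)) section_cat; apply: directed_section.
apply: fP; rewrite size_takel// size_drop -(leq_add2l n) subnKC; last first.
  by rewrite (leq_trans _ le_w)// leq_addr.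
by rewrite (leq_trans _ le_w)// leq_add2l leq_bigmax.
Qed.

End NoFinitary.

(** * Generation by the sections at a level *)

Section Generation.

Lemma subgroup_generated (T : groupType) (Y : set T) : subgroup (generated Y).
Proof.
split; first by rewrite inE => M [[M1 _] _]; rewrite inE in M1.
move=> g h; rewrite !inE => gY hY M MP; have [[_ MF] _] := MP.
by have := MF g h; rewrite !inE; apply; [apply: gY|apply: hY].
Qed.

Lemma subgroupP (T : groupType) (G : set T) :
  subgroup G <-> G 1 /\ (forall g h, G g -> G h -> G (g / h)).
Proof.
split=> [[G1 GF]|[G1 GF]]; first split.
- by rewrite inE in G1.
- by move=> g h Gg Gh; have := GF g h; rewrite !inE; apply.
- by split=> [|g h]; rewrite ?inE//; apply: GF.
Qed.

Lemma generated_min (T : groupType) (Y G : set T) :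
  subgroup G -> Y `<=` G -> generated Y `<=` G.
Proof. exact: smallest_sub. Qed.

Lemma sub_generated (T : groupType) (Y : set T) : Y `<=` generated Y.
Proof. exact: sub_gen_smallest. Qed.

Lemma generated_image (T U : groupType) (f : T -> U) (Y : set T) :
  f 1 = 1 -> {morph f : g h / g / h} ->
  generated (f @` Y) = f @` generated Y.
Proof.
move=> f1 fF; have [G1 GF] := (subgroupP _).1 (subgroup_generated Y).
have [H1 HF] := (subgroupP _).1 (subgroup_generated (f @` Y)).
apply/seteqP; split.
  apply: generated_min.
    apply/subgroupP; split; first by exists 1.
    by move=> _ _ [g Gg <-] [h Gh <-]; exists (g / h); rewrite ?fF//; apply: GF.
  by apply: image_subset; apply: sub_generated.
suff: generated Y `<=` f @^-1` generated (f @` Y) by move=> sub _ [g /sub ? <-].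
apply: generated_min; last by move=> g Yg; apply: sub_generated; exists g.
apply/subgroupP; split=> [|g h]; rewrite /= ?f1// fF; exact: HF.
Qed.

Variable X : finType.
Implicit Types (G S : set (treeAut X)) (g : treeAut X) (w : seq X).

Lemma replicating_word G : self_replicating G -> forall w g, G g ->
  exists2 h, G h & h w = w /\ section h w = g.
Proof.
move=> [_ _ repG]; elim=> [|x w IH] g Gg.
  by exists g; rewrite // treeAut_nil section_nil.
have [h Gh [hw hg]] := IH g Gg.
have: G h by []; rewrite -{1}(repG x) => -[k [Gk kx] ek].
by exists k => //; rewrite -cat1s sectionE section_cat kx ek hw.
Qed.

(** The automorphisms whose sections at level [n] all lie in the subgroup
    generated by the sections of [S] at that level form a subgroup containing
    [S], hence containing [G]; by self-replication every element of [G] is a section at level [n] of an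
    element of [G]. *)
Lemma generated_by_sections G S n : (0 < #|X|)%N ->
  self_replicating G -> generated S = G ->
  generated [set section s (val t) | s in S & t in [set: n.-tuple X]] = G.
Proof.
move=> /card_gt0P[x0 _] repG genS; have [ssG _ _] := repG.
have sG : subgroup G by rewrite -genS; apply: subgroup_generated.
set Y := (X in generated X).
have [Y1 YF] := (subgroupP _).1 (subgroup_generated Y).
apply/seteqP; split.
  apply: generated_min => // _ [s Ss [t _ <-]]; apply: ssG.
  by rewrite -genS; apply: sub_generated.
move=> g Gg.
have [h Gh [_ <-]] := replicating_word repG (nseq n x0) Gg.
have: size (nseq n x0) = n by rewrite size_nseq.
move: (nseq n x0); move: Gh; rewrite -genS; move: h {g Gg}.
suff: generated S `<=`
    [set h | forall w, size w = n -> generated Y (section h w)].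
  by move=> sub h /sub.
apply: generated_min; last first.
  move=> s Ss w /tuple_of_size[t <-]; apply: sub_generated.
  by exists s => //; exists t.
apply/subgroupP; split=> [w _|g h gP hP w sw]; first by rewrite section1.
rewrite sectionM sectionV.
by apply: YF; [apply: gP|apply: hP]; rewrite treeAut_size.
Qed.

End Generation.

(** * Words over the alphabet of blocks *)

Section Blocks.
Variables (X : finType) (m : nat).
Notation O := (m.-tuple X).
Implicit Types (g h : treeAut X) (o : O) (s t : seq O).

Definition unblock s : seq X := flatten (map val s).

(** The recursion through sections makes the sections at a block immediate, at
    the price of proving the link with [g] itself in [unblock_block]. *)
Fixpoint block_fun g s : seq O :=
  if s is o :: s' then level_perm_fun g o :: block_fun (section g o) s'
  else [::].

Lemma block_fun1 s : block_fun 1 s = s.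
Proof.
by elim: s => //= o s IH; rewrite section1 IH; congr (_ :: _); apply: val_inj.
Qed.

Lemma block_funM g h s : block_fun (g * h) s = block_fun g (block_fun h s).
Proof.
elim: s g h => //= o s IH g h; rewrite sectionM IH; congr (_ :: _).
exact: val_inj.
Qed.

Lemma block_bij g : bijective (block_fun g).
Proof.
by exists (block_fun g^-1) => s; rewrite -block_funM ?mulVg ?mulgV block_fun1.
Qed.

Lemma block_prefix g s t : prefix s t = prefix (block_fun g s) (block_fun g t).
Proof.
elim: s t g => [|o s IH] [|o' t] g //=.
rewrite (inj_eq (@level_perm_inj _ _ g)).
by have [->|//] := eqVneq o o'; rewrite -IH.
Qed.

Definition block g : treeAut O := TreeAut (block_bij g) (block_prefix g).

Lemma block1 : block 1 = 1.
Proof. by apply: treeAutP => s; rewrite /= block_fun1. Qed.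

Lemma blockM : {morph block : g h / g * h}.
Proof. by move=> g h; apply: treeAutP => s; rewrite /= block_funM. Qed.

Lemma blockF : {morph block : g h / g / h}.
Proof.
move=> g h; rewrite blockM; congr (_ * _).
by apply: (mulgI (block h)); rewrite -blockM !mulgV block1.
Qed.

Lemma section_block g o : section (block g) [:: o] = block (section g o).
Proof. by apply: section_uniq => s. Qed.

Lemma unblock_block g s : unblock (block g s) = g (unblock s).
Proof.
elim: s g => [|o s IH] g; first exact: esym (treeAut_nil g).
rewrite -[LHS]/(g o ++ unblock (block (section g o) s)) IH.
by rewrite -[unblock (o :: s)]/(o ++ unblock s) sectionE.
Qed.

Lemma unblock_surj k (w : seq X) :
  size w = (m * k)%N -> exists s, unblock s = w.
Proof.
elim: k w => [|k IH] w sw.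
  by exists [::]; apply/esym/size0nil; rewrite sw muln0.
have /tuple_of_size[o eo] : size (take m w) = m.
  by rewrite size_takel// sw leq_pmulr.
have [|s es] := IH (drop m w); first by rewrite size_drop sw mulnS addKn.
by exists (o :: s); rewrite -[LHS]/(o ++ unblock s) eo es cat_take_drop.
Qed.

(** An automorphism in the kernel fixes all words whose length is a multiple of
    [m], and every word extends to one of these. *)
Lemma block_inj : (0 < m)%N -> (0 < #|X|)%N -> injective block.
Proof.
move=> m_gt0 /card_gt0P[x0 _] g h egh.
suff : h^-1 * g = 1 by move=> e; rewrite -[g](mulKVg h) e mulg1.
have: block (h^-1 * g) = 1 by rewrite blockM egh -blockM mulVg block1.
move: (h^-1 * g) => {egh}g {h} g1; apply: treeAut_eq1 => w.
exists (nseq (m * size w - size w) x0).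
have [|s <-] := @unblock_surj (size w) (w ++ nseq (m * size w - size w) x0).
  by rewrite size_cat size_nseq subnKC// leq_pmull.
by rewrite -unblock_block g1.
Qed.

End Blocks.

(** A directed automorphism recurs at all the powers of its recurrence word, so a
    product of the individual periods is a common one. *)
Lemma common_period (X : finType) (Y : set (treeAut X)) :
  finite_set Y -> (forall y, Y y -> directed y) ->
  exists2 m, (0 < m)%N &
    forall y, Y y -> exists2 w, size w = m & section y w = y.
Proof.
move=> /finite_seqP[l ->] dirY.
have per_mul (w : seq X) k (y : treeAut X) : section y w = y ->
    size (flatten (nseq k w)) = (k * size w)%N /\
    section y (flatten (nseq k w)) = y.
  move=> yw; rewrite (section_iter k yw); split=> //.
  by elim: k => //= k IH; rewrite size_cat IH mulSn.
elim: l dirY => [|y l IH] dirY; first by exists 1%N.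
have [|m m_gt0 mP] := IH.
  by move=> z zl; apply: dirY; rewrite /= inE; apply/orP; right.
have [|_ [w w_neq yw]] := dirY y; first by rewrite /= inE eqxx.
exists (m * size w)%N; first by rewrite muln_gt0 m_gt0 lt0n size_eq0.
move=> z /=; rewrite inE => /orP[/eqP ->|/mP[v sv zv]].
  by have [? ?] := per_mul w m y yw; exists (flatten (nseq m w)).
have [? ?] := per_mul v (size w) z zv; exists (flatten (nseq (size w) v)) => //.
by rewrite mulnC -sv.
Qed.

(** * The generalized basilica representation *)

Theorem proposition1p9 (X : finType) (G : set (treeAut X)) :
  (2 <= #|X|)%N ->
  subgroup G -> torsion_free G ->
  self_replicating G -> bounded_automata_group G ->
  exists (O : finType) (H : set (treeAut O)),
    generalized_basilica_group H /\ isomorphic G H.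
Proof.
move=> X_ge2 sG tfG repG [[S [finS genS]] ssG autG].
have X_gt0 : (0 < #|X|)%N by apply: ltnW.
have SG : S `<=` G by rewrite -genS; apply: sub_generated.
have [n nP] : exists n, forall s, S s -> forall w, (n <= size w)%N ->
    directed (section s w).
  move/finite_seqP: finS SG => [l ->] {genS}.
  elim: l => [|s l IH] lG; first by exists 0%N.
  have [|n nP] := IH.
    by move=> t tl; apply: lG; rewrite /= inE; apply/orP; right.
  have Gs : G s by apply: lG; rewrite /= inE eqxx.
  have [bs fs] := autG s Gs.
  have [k kP] := eventually_directed X_gt0 tfG ssG Gs bs fs.
  exists (maxn n k) => t /=; rewrite inE => /orP[/eqP ->|tl] w;
    rewrite geq_max => /andP[nw kw].
    exact: kP.
  exact: nP tl _ nw.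
pose Y := [set section s (val t) | s in S & t in [set: n.-tuple X]].
have genY : generated Y = G by apply: generated_by_sections.
have finY : finite_set Y by apply: finite_image2 => //; apply: finite_finset.
have dirY y : Y y -> directed y.
  by move=> [s Ss [t _ <-]]; apply: nP; rewrite // size_tuple.
have [m m_gt0 mP] := common_period finY dirY.
exists (m.-tuple X : finType), (@block X m @` G).
have blockI := @block_inj X m m_gt0 X_gt0.
split; last first.
  exists (@block X m); split; first by move=> g h _ _; apply: blockM.
  split=> [g Gg|g h _ _ /blockI//|]; first by exists g.
  by move=> _ [g Gg <-]; exists g.
have genH : generated (@block X m @` Y) = @block X m @` G.
  by rewrite generated_image ?genY//; [apply: block1|apply: blockF].
split.
- rewrite card_tuple (leq_trans X_ge2)// -{1}(expn1 #|X|).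
  by rewrite leq_pexp2l.
- by rewrite -genH; apply: subgroup_generated.
exists (@block X m @` Y); split=> //; first exact: finite_image.
move=> _ [y Yy <-].
have [->|y_neq1] := eqVneq y 1.
  by left=> o; rewrite section_block section1 block1.
right; have [thin_y _] := dirY y Yy.
have [w sw yw] := mP y Yy; have [o eo] := tuple_of_size sw; subst w.
have sec_y (o' : m.-tuple X) : section y o' != 1 -> o' = o.
  by move=> no'; apply: val_inj; apply: thin_y; rewrite ?yw ?size_tuple.
split.
  move=> o'; rewrite section_block.
  have [->|/sec_y ->] := eqVneq (section y o') 1; first by left; apply: block1.
  by right; rewrite yw.
exists o; split; first by rewrite section_block yw.
by move=> o'; rewrite section_block => /blockI eo'; apply/esym/sec_y; rewrite eo'.
Qed.
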